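(* Let $i:*\to X$ and $j:*\to Y$ be HDA. The following are equivalent: (1) $X$ and $Y$ are bisimilar; (2) there is a precubical subset $R\subseteq X\times Y$ with $(i,j)\in R$ such that for all reachable $x_1\in X$, $y_1\in Y$ with $(x_1,y_1)\in R$: for any $x_2\in X$ with $x_1=\delta_k^0x_2$ for some $k$ there is $y_2\in Y$ with $y_1=\delta_k^0y_2$ and $(x_2,y_2)\in R$; and for any $y_2\in Y$ with $y_1=\delta_k^0y_2$ for some $k$ there is $x_2\in X$ with $x_1=\delta_k^0x_2$ and $(x_2,y_2)\in R$; (3) there is a precubical subset $R\subseteq X\times Y$ with $(i,j)\in R$ such that for all reachable $x_1\in X$, $y_1\in Y$ with $(x_1,y_1)\in R$: for any cube path $(x_1,\dots,x_m)$ in $X$ there is a cube path $(y_1,\dots,y_m)$ in $Y$ with $(x_p,y_p)\in R$ for all $p=1,\dots,m$; and for any cube path $(y_1,\dots,y_m)$ in $Y$ there is a cube path $(x_1,\dots,x_m)$ in $X$ with $(x_p,y_p)\in R$ for all $p$.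
   Context: A precubical set $X$: sets $(X_n)_{n\in\mathbb N}$ ($n$-cubes) with face maps $\delta_k^\nu:X_n\to X_{n-1}$ ($n\ge1$, $1\le k\le n$, $\nu\in\{0,1\}$), $\delta_k^\nu\delta_\ell^\mu=\delta_{\ell-1}^\mu\delta_k^\nu$ for $k<\ell$; morphisms are degree-preserving maps commuting with face maps. An HDA $i:*\to X$ is a precubical set with distinguished $0$-cube $i$; HDA morphisms preserve it (category $\mathsf{HDA}$). $X\times Y$ is the precubical set with $(X\times Y)_n=X_n\times Y_n$ and componentwise face maps; a precubical subset $R\subseteq X\times Y$ is a graded subset closed under all face maps, i.e. $(x,y)\in R$ implies $(\delta_k^\nu x,\delta_k^\nu y)\in R$. A cube path is a sequence $(x_1,\dots,x_m)$ with, for each $j<m$, some $k$ with $x_j=\delta_k^0x_{j+1}$ or $x_{j+1}=\delta_k^1x_j$; pointed if $x_1=i$; $x$ is reachable if there is a pointed cube path ending at $x$. A precubical set $P$ is a precubical path object if there is a sequence $(x_1,\dots,x_m)$ of pairwise distinct elements forming a cube path such that every $x\in P$ equals $\delta_{k_1}^{\nu_1}\cdots\delta_{k_p}^{\nu_p}x_j$ for some $j$, some $\nu$'s and a unique sequence $k_1<\dots<k_p$. A morphism $f:P\to Q$ of path objects with representations $(x_1,\dots,x_m)$, $(y_1,\dots,y_q)$ is a cube path extension if $f(x_j)=y_j$ for $j\le m$. $\mathsf{HDP}$ is the subcategory of $\mathsf{HDA}$ of path objects pointed at $x_1$ with morphisms generated by isomorphisms and pointed cube path extensions. A morphism $f:X\to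 Y$ of $\mathsf{HDA}$ is open if for all $g:P\to Q$ in $\mathsf{HDP}$ and $p:P\to X$, $q:Q\to Y$ in $\mathsf{HDA}$ with $f\circ p=q\circ g$ there is $r:Q\to X$ in $\mathsf{HDA}$ with $r\circ g=p$ and $f\circ r=q$. HDA $X,Y$ are bisimilar if there are an HDA $Z$ and open maps $Z\to X$, $Z\to Y$.
   Formalization: In a path object the k's and ν's are unique for each x_j, and a common face of x_j and x_l must be a face of every x_q in between; in (3) the matching cube path must use the same face maps (same k and ν) at each step. Without these changes the equivalence fails. *)

(* Defs.v *)
From Stdlib Require List.
From mathcomp Require Import all_boot.

Set Implicit Arguments.
Unset Strict Implicit.
Unset Printing Implicit Defensive.

(* Face indices are numbered from 0: [face i nu] on (n+1)-cubes is
   delta_(i+1)^nu, with [nu = false] for lower (0) and [nu = true] for upper (1)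
   faces. In [face_face], i stands for k - 1 and j for l - 2, so that k < l
   reads i <= j; [lift ord0 j] has value j + 1. *)
Record precubical := Precubical {
  cube :> nat -> Type;
  face : forall n, 'I_n.+1 -> bool -> cube n.+1 -> cube n;
  face_face : forall n (i j : 'I_n.+1) (nu mu : bool) (x : cube n.+2),
    i <= j ->
    face i nu (face (lift ord0 j) mu x) =
    face j mu (face (widen_ord (leqnSn n.+1) i) nu x)
}.

Record pc_hom (X Y : precubical) := PcHom {
  pc_fun :> forall n, X n -> Y n;
  pc_face : forall n (i : 'I_n.+1) (nu : bool) (x : X n.+1),
    pc_fun (face i nu x) = face i nu (pc_fun x)
}.

Definition prod_face (X Y : precubical) n (i : 'I_n.+1) (nu : bool)
  (z : X n.+1 * Y n.+1) : X n * Y n := (face i nu z.1, face i nu z.2).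

Lemma prod_face_face (X Y : precubical) n (i j : 'I_n.+1) (nu mu : bool)
    (z : X n.+2 * Y n.+2) :
  i <= j ->
  prod_face i nu (prod_face (lift ord0 j) mu z) =
  prod_face j mu (prod_face (widen_ord (leqnSn n.+1) i) nu z).
Proof. by move=> le_ij; rewrite /prod_face /= !face_face. Qed.

Definition pc_prod (X Y : precubical) : precubical :=
  @Precubical (fun n => (X n * Y n)%type) (@prod_face X Y)
    (@prod_face_face X Y).

Definition precubical_subset (X : precubical) (S : forall n, X n -> Prop) :=
  forall n (i : 'I_n.+1) (nu : bool) (x : X n.+1),
    S n.+1 x -> S n (face i nu x).

Record hda := Hda {
  hda_pc :> precubical;
  init : hda_pc 0
}.

Record hda_hom (X Y : hda) := HdaHom {
  hda_pc_hom :> pc_hom X Y;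
  hda_init : hda_pc_hom 0 (init X) = init Y
}.

Lemma comp_face (X Y Z : hda) (g : hda_hom Y Z) (f : hda_hom X Y)
    n (i : 'I_n.+1) (nu : bool) (x : X n.+1) :
  g n (f n (face i nu x)) = face i nu (g n.+1 (f n.+1 x)).
Proof. by rewrite !pc_face. Qed.

Lemma comp_init (X Y Z : hda) (g : hda_hom Y Z) (f : hda_hom X Y) :
  g 0 (f 0 (init X)) = init Z.
Proof. by rewrite !hda_init. Qed.

Definition hda_comp (X Y Z : hda) (g : hda_hom Y Z) (f : hda_hom X Y) :
    hda_hom X Z :=
  @HdaHom X Z (@PcHom X Z (fun n x => g n (f n x)) (@comp_face X Y Z g f))
    (comp_init g f).

(* The elements of X of all degrees, needed because the members of a cube path
   have varying degrees. *)
Definition cell (X : precubical) := {n : nat & X n}.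
Definition Cell (X : precubical) n (x : X n) : cell X := Tagged (cube X) x.

Definition cell_map (X Y : precubical) (f : pc_hom X Y) (x : cell X) : cell Y :=
  Cell (f (tag x) (tagged x)).

Definition is_face (X : precubical) (k : nat) (nu : bool) (x y : cell X) :=
  exists n (i : 'I_n.+1) (z : X n.+1),
    [/\ i = k :> nat, y = Cell z & x = Cell (face i nu z)].

(* [w] is the sequence of the pairs (k_1, nu_1), ..., (k_p, nu_p), and [x] is
   delta_(k_1)^(nu_1) ... delta_(k_p)^(nu_p) y. *)
Fixpoint iter_face (X : precubical) (w : seq (nat * bool)) (x y : cell X) :=
  if w is (k, nu) :: w' then
    exists2 z, is_face k nu x z & iter_face w' z y
  else x = y.

Definition face_of (X : precubical) (w : seq (nat * bool)) (x y : cell X) :=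
  sorted ltn (unzip1 w) /\ iter_face w x y.

Definition step (X : precubical) (a : nat * bool) (x y : cell X) :=
  if a.2 then is_face a.1 true y x else is_face a.1 false x y.

(* As with [path], the cube path (x_1, ..., x_m) is given by its head and its
   tail, so that m >= 1; [w] lists the face maps witnessing its steps. Cube
   paths matched by a bisimulation must have the same [w]: if the index k of a
   step is forgotten, the path-wise condition no longer implies the step-wise
   one (take one vertex, edges a and b, and one square whose faces are all b
   except delta_1^0 = a, against the same with delta_2^0 = a). *)
Fixpoint cube_path_via (X : precubical) (w : seq (nat * bool))
    (x : cell X) (s : seq (cell X)) :=
  match w, s with
  | [::], [::] => True
  | a :: w', y :: s' => step a x y /\ cube_path_via w' y s'
  | _, _ => False
  end.

Definition cube_path (X : precubical) (x : cell X) (s : seq (cell X)) :=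
  exists w, cube_path_via w x s.

Definition reachable (X : hda) n (x : X n) :=
  exists2 s, cube_path (Cell (init X)) s & last (Cell (init X)) s = Cell x.

(* The last two fields render the requirement that each element be an iterated
   face of some x_j in a unique way. Uniqueness can only be meant up to what the
   cube path itself forces, since if x_j is a face of x_(j+1), then so are all
   faces of x_j. Hence it is required for each j separately, and faces shared
   by x_j and x_l must be passed on through all cubes in between. Without this,
   an edge from x_1 to itself would be a path object, and unfolding a loop
   would not be an open map. *)
Record path_repr (X : precubical) (x1 : cell X) (s : seq (cell X)) : Prop := {
  repr_path : cube_path x1 s;
  repr_distinct : List.NoDup (x1 :: s);
  repr_gen : forall x, exists j w,
    j <= size s /\ face_of w x (nth x1 (x1 :: s) j);
  repr_unique : forall x j w w', j <= size s ->
    face_of w x (nth x1 (x1 :: s) j) -> face_of w' x (nth x1 (x1 :: s) j) ->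
    w = w';
  repr_link : forall x j q l w w', j <= q <= l -> l <= size s ->
    face_of w x (nth x1 (x1 :: s) j) -> face_of w' x (nth x1 (x1 :: s) l) ->
    exists w'', face_of w'' x (nth x1 (x1 :: s) q)
}.

Definition path_object (P : hda) :=
  exists s, path_repr (Cell (init P)) s.

Definition hda_iso (P Q : hda) (f : hda_hom P Q) :=
  exists g : hda_hom Q P,
    (forall n, cancel (f n) (g n)) /\ (forall n, cancel (g n) (f n)).

Definition pointed_extension (P Q : hda) (f : hda_hom P Q) :=
  exists s t, [/\ path_repr (Cell (init P)) s, path_repr (Cell (init Q)) t
    & exists t', Cell (init Q) :: t =
                 map (cell_map f) (Cell (init P) :: s) ++ t'].

Inductive hdp_hom : forall P Q : hda, hda_hom P Q -> Prop :=
| HdpIso (P Q : hda) (f : hda_hom P Q) :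
    path_object P -> path_object Q -> hda_iso f -> hdp_hom f
| HdpExt (P Q : hda) (f : hda_hom P Q) : pointed_extension f -> hdp_hom f
| HdpComp (P Q S : hda) (f : hda_hom P Q) (g : hda_hom Q S) :
    hdp_hom f -> hdp_hom g -> hdp_hom (hda_comp g f).

Definition open_map (X Y : hda) (f : hda_hom X Y) :=
  forall (P Q : hda) (g : hda_hom P Q), hdp_hom g ->
  forall (p : hda_hom P X) (q : hda_hom Q Y),
    (forall n (x : P n), f n (p n x) = q n (g n x)) ->
    exists r : hda_hom Q X,
      (forall n (x : P n), r n (g n x) = p n x) /\
      (forall n (y : Q n), f n (r n y) = q n y).

Definition bisimilar (X Y : hda) :=
  exists (Z : hda) (f : hda_hom Z X) (g : hda_hom Z Y),
    open_map f /\ open_map g.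

Definition cell_rel (X Y : precubical)
    (R : forall n, pc_prod X Y n -> Prop) (x : cell X) (y : cell Y) :=
  exists n (a : X n) (b : Y n), [/\ x = Cell a, y = Cell b & R n (a, b)].

(* Main.v *)
Require Import Defs.
From Stdlib Require List.
From Stdlib Require Import Eqdep_dec ClassicalEpsilon ProofIrrelevance.
From mathcomp Require Import all_boot.

Set Implicit Arguments.
Unset Strict Implicit.
Unset Printing Implicit Defensive.

(* A map f : Z -> X is open iff lower-face steps lift along it: if z is
   reachable and f z = delta_k^0 x, then z = delta_k^0 y for some y over x. Both
   directions rest on two facts about path objects.
   Universal property: a morphism out of a path object is the same as a cube
   path, in the target, with the same sequence of face maps. It exists because
   two expressions of an element as a face of members of the representation are
   related through the members in between, by identities that hold in every
   precubical set.
   Existence: every sequence of face maps occurring in a pointed cube path is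
   realised by a path object, namely by the faces of the members of a cube path
   in a standard cube {0, *, 1}^N, with one coordinate for each event started.
   Bisimilarity gives the relation of all (f z, g z) with z reachable, which is
   closed under faces because faces of reachable cubes are reachable; conversely
   a relation R, as a subobject of X x Y, has open projections. *)

(** * Faces of cells *)

(** Degrees have decidable equality, so equal dependent pairs have equal second components, without
    an axiom. *)
Lemma Cell_inj (X : precubical) n (x y : X n) : Cell x = Cell y -> x = y.
Proof. exact: (inj_pair2_eq_dec _ PeanoNat.Nat.eq_dec). Qed.

Lemma is_face_inv (X : precubical) n (z : X n.+1) k nu (x : cell X) :
  is_face k nu x (Cell z) ->
  exists i : 'I_n.+1, i = k :> nat /\ x = Cell (face i nu z).
Proof.
case=> m [i [z' [ik e ->]]].
have /= [en] := f_equal (@tag _ _) e.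
by subst m; exists i; rewrite (Cell_inj e).
Qed.

Lemma is_face_face (X : precubical) n (i : 'I_n.+1) nu (z : X n.+1) :
  is_face i nu (Cell (face i nu z)) (Cell z).
Proof. by exists n, i, z. Qed.

Lemma is_face_Cell (X : precubical) n (i : 'I_n.+1) nu (x : X n) (z : X n.+1) :
  is_face i nu (Cell x) (Cell z) -> x = face i nu z.
Proof. by case/is_face_inv=> j [/val_inj-> /Cell_inj]. Qed.

Lemma is_face_lt (X : precubical) k nu (x y : cell X) :
  is_face k nu x y -> k < tag y.
Proof. by case=> n [i [z [<- -> _]]] /=. Qed.

Lemma is_face_tag (X : precubical) k nu (x y : cell X) :
  is_face k nu x y -> tag y = (tag x).+1.
Proof. by case=> n [i [z [_ -> ->]]]. Qed.

Lemma is_face_ex (X : precubical) k nu (y : cell X) :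
  k < tag y -> exists x, is_face k nu x y.
Proof.
case: y => [[|n] z] //= lt_k; exists (Cell (face (Ordinal lt_k) nu z)).
by exists n, (Ordinal lt_k), z.
Qed.

Lemma is_face_fun (X : precubical) k nu (x x' y : cell X) :
  is_face k nu x y -> is_face k nu x' y -> x = x'.
Proof.
case=> n [i [z [ik -> ->]]] /is_face_inv[j [jk ->]].
by rewrite (_ : i = j) //; apply: val_inj; rewrite /= ik jk.
Qed.

Lemma is_face_swap (X : precubical) i j nu mu (x y z : cell X) : i <= j ->
  is_face i nu x y -> is_face j.+1 mu y z ->
  exists2 y', is_face j mu x y' & is_face i nu y' z.
Proof.
move=> le_ij f1 [m [j' [z' [ej -> ey]]]].
have := is_face_tag f1; rewrite ey /= => em.
case: m => [|n] in j' z' ej ey em *; first by have := ltn_ord j'; rewrite ej.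
rewrite ey in f1; have [i' [ei ->]] := is_face_inv f1.
have lt_j : j < n.+1 by have := ltn_ord j'; rewrite ej.
have -> : j' = lift ord0 (Ordinal lt_j) by apply: val_inj.
rewrite face_face ?ei //.
exists (Cell (face (widen_ord (leqnSn n.+1) i') nu z')).
  by exists n, (Ordinal lt_j), (face (widen_ord (leqnSn n.+1) i') nu z').
by exists n.+1, (widen_ord (leqnSn n.+1) i'), z'.
Qed.

(** The faces in the other order exist for reasons of degree; [is_face_swap] turns them back into
    the given order, and uniqueness of faces identifies the results. *)
Lemma is_face_swapV (X : precubical) i j nu mu (x y z : cell X) : i <= j ->
  is_face j mu x y -> is_face i nu y z ->
  exists2 y', is_face i nu x y' & is_face j.+1 mu y' z.
Proof.
move=> le_ij f1 f2.
have lt_j := is_face_lt f1; have ez := is_face_tag f2.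
have [y' f3] : exists y', is_face j.+1 mu y' z by apply: is_face_ex; rewrite ez.
have [x' f4] : exists x', is_face i nu x' y'.
  apply: is_face_ex; have := is_face_tag f3; rewrite ez => -[<-].
  exact: leq_ltn_trans lt_j.
have [y'' f5 f6] := is_face_swap le_ij f4 f3.
rewrite (is_face_fun f2 f6) in f1.
by exists y' => //; rewrite (is_face_fun f1 f5).
Qed.

Lemma is_face_map (X Y : precubical) (f : pc_hom X Y) k nu (x y : cell X) :
  is_face k nu x y -> is_face k nu (cell_map f x) (cell_map f y).
Proof.
case=> n [i [z [ik -> ->]]]; exists n, i, (f _ z); split=> //.
by rewrite /cell_map /= pc_face.
Qed.

Lemma iter_face_map (X Y : precubical) (f : pc_hom X Y) u (x y : cell X) :
  iter_face u x y -> iter_face u (cell_map f x) (cell_map f y).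
Proof.
elim: u x => [|[k nu] u IHu] x /=; first by move->.
by case=> z fz /IHu; exists (cell_map f z) => //; apply: is_face_map.
Qed.

Lemma iter_face_fun (X : precubical) u (x x' y : cell X) :
  iter_face u x y -> iter_face u x' y -> x = x'.
Proof.
elim: u x x' => [|[k nu] u IHu] x x' /=; first by move=> -> ->.
case=> z f1 /IHu e [z' f2 /e ez]; rewrite -ez in f2.
exact: is_face_fun f1 f2.
Qed.

Lemma iter_face_tag (X : precubical) u (x y : cell X) :
  iter_face u x y -> tag y = size u + tag x.
Proof.
elim: u x => [|[k nu] u IHu] x /=; first by move->.
by case=> z /is_face_tag fz /IHu ->; rewrite fz addnS.
Qed.

(** Whether a word of faces applies to a cell depends only on the degree of the cell. *)
Lemma iter_face_ex (X Y : precubical) u (x y : cell X) (y' : cell Y) :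
  tag y = tag y' -> iter_face u x y -> exists x', iter_face u x' y'.
Proof.
move=> eyy; elim: u x => [|[k nu] u IHu] x /=; first by exists y'.
case=> z fz fy; have [z' fz'] := IHu _ fy.
have ez : tag z = tag z'.
  apply/eqP; rewrite -(eqn_add2l (size u)) -(iter_face_tag fy).
  by rewrite -(iter_face_tag fz') eyy.
have [x' fx'] : exists x', is_face k nu x' z'.
  by apply: is_face_ex; rewrite -ez (is_face_lt fz).
by exists x', z'.
Qed.

Lemma iter_face_rcons (X : precubical) u k nu (x y z : cell X) :
  iter_face u x y -> is_face k nu y z -> iter_face (rcons u (k, nu)) x z.
Proof.
elim: u x => [|[l mu] u IHu] x /=; first by move=> -> f; exists z.
by case=> t ft /IHu fy /fy; exists t.
Qed.

(* Sorting a word of faces with the rule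
   delta_k delta_l = delta_l delta_(k+1) for l <= k. *)
Fixpoint insert_face (k : nat) (nu : bool) (u : seq (nat * bool)) :=
  if u is (l, mu) :: u' then
    if k < l then (k, nu) :: u else (l, mu) :: insert_face k.+1 nu u'
  else [:: (k, nu)].

Definition sort_faces (u : seq (nat * bool)) :=
  foldr (fun a => insert_face a.1 a.2) [::] u.

(** Each index passed is at most the current [k], which is then raised by one, so the inserted index
    ends strictly above all those passed. *)
Lemma insert_face_path l k nu u : l < k -> path ltn l (unzip1 u) ->
  path ltn l (unzip1 (insert_face k nu u)).
Proof.
elim: u l k => [|[m mu] u IHu] l k lt_lk /=; first by rewrite lt_lk.
case/andP=> lt_lm pu; case: ifP => [lt_km|/negbT] /=.
  by rewrite lt_lk lt_km.
by rewrite -leqNgt lt_lm => le_mk; apply: IHu.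
Qed.

Lemma face_of_insert (X : precubical) k nu u (x y z : cell X) :
  is_face k nu x y -> face_of u y z -> face_of (insert_face k nu u) x z.
Proof.
move=> fx [su fu]; split.
  case: u su {fu} => [|[l mu] u] //= su; case: ifP => [lt_kl|/negbT] /=.
    by rewrite lt_kl.
  by rewrite -leqNgt => le_lk; apply: insert_face_path.
elim: u k x y fx fu {su} => [|[l mu] u IHu] k x y fx /=.
  by move=> <-; exists y.
case=> t fy fu; case: ifP => [_|/negbT] /=; first by exists y => //; exists t.
rewrite -leqNgt => le_lk; have [y' f1 f2] := is_face_swapV le_lk fx fy.
by exists y' => //; apply: IHu f2 fu.
Qed.

Lemma face_of_sort (X : precubical) u (x y : cell X) :
  iter_face u x y -> face_of (sort_faces u) x y.
Proof.
elim: u x => [|[k nu] u IHu] x /=; first by [].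
by case=> z fz /IHu; apply: face_of_insert.
Qed.

(** The resulting word is computed from [u], [k] and [nu] alone, so passing a face relation along
    one step of a cube path takes the same form in every precubical set. *)
Lemma face_of_rcons (X : precubical) u k nu (x y z : cell X) :
  face_of u x y -> is_face k nu y z ->
  face_of (sort_faces (rcons u (k, nu))) x z.
Proof. by case=> _ fu fy; apply/face_of_sort/(iter_face_rcons fu). Qed.

(** * Cube paths *)

Lemma step_map (X Y : precubical) (f : pc_hom X Y) a (x y : cell X) :
  step a x y -> step a (cell_map f x) (cell_map f y).
Proof. by rewrite /step; case: a.2; apply: is_face_map. Qed.

Lemma step_tag (X Y : precubical) a (x y : cell X) (x' y' : cell Y) :
  step a x y -> step a x' y' -> tag x = tag x' -> tag y = tag y'.
Proof.
rewrite /step; case: a.2 => /is_face_tag -> /is_face_tag -> //.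
  by case.
by move->.
Qed.

Lemma cube_path_via_map (X Y : precubical) (f : pc_hom X Y) w (x : cell X) s :
  cube_path_via w x s ->
  cube_path_via w (cell_map f x) (map (cell_map f) s).
Proof.
elim: w x s => [|a w IHw] x [|y s] //= [st /IHw p]; split=> //.
exact: step_map.
Qed.

Lemma cube_path_via_size (X : precubical) w (x : cell X) s :
  cube_path_via w x s -> size w = size s.
Proof. by elim: w x s => [|a w IHw] x [|y s] //= [_ /IHw ->]. Qed.

Lemma cube_path_via_cat (X : precubical) w w' (x : cell X) s s' :
  cube_path_via w x s -> cube_path_via w' (last x s) s' ->
  cube_path_via (w ++ w') x (s ++ s').
Proof.
by elim: w x s => [|a w IHw] x [|y s] //= [st p] p'; split=> //; apply: IHw.
Qed.

Lemma cube_path_via_split (X : precubical) w (x : cell X) s s' :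
  cube_path_via w x (s ++ s') ->
  exists w1 w2, [/\ w = w1 ++ w2, cube_path_via w1 x s
                  & cube_path_via w2 (last x s) s'].
Proof.
elim: s x w => [|y s IHs] x w /=; first by exists [::], w.
case: w => [|a w] //= [st /IHs[w1 [w2 [-> p1 p2]]]].
by exists (a :: w1), w2.
Qed.

Lemma cube_path_via_nth (X : precubical) w (x : cell X) s x0 j :
  cube_path_via w x s -> j < size s ->
  step (nth (0, false) w j) (nth x0 (x :: s) j) (nth x0 (x :: s) j.+1).
Proof.
elim: w x s j => [|a w IHw] x [|y s] [|j] //= [st p] //.
exact: IHw p.
Qed.

Lemma cube_path_via_tag (X Y : precubical) w (x : cell X) s (x' : cell Y) s' j :
  cube_path_via w x s -> cube_path_via w x' s' -> tag x = tag x' ->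
  j <= size s -> tag (nth x (x :: s) j) = tag (nth x' (x' :: s') j).
Proof.
move=> p p' e; have es : size s = size s'.
  by rewrite -(cube_path_via_size p) (cube_path_via_size p').
elim: j => [|j IHj] // lt_j.
apply: (step_tag (cube_path_via_nth x p lt_j)) (IHj (ltnW lt_j)).
by apply: cube_path_via_nth p' _; rewrite -es.
Qed.

(** * The universal property of path objects *)

Section Universal.

Variables (P Z : precubical) (x1 : cell P) (s : seq (cell P)).
Variables (z1 : cell Z) (t : seq (cell Z)) (w : seq (nat * bool)).
Hypotheses (reprP : path_repr x1 s) (ps : cube_path_via w x1 s).
Hypotheses (pt : cube_path_via w z1 t) (e1 : tag x1 = tag z1).

Let xs j := nth x1 (x1 :: s) j.
Let zs j := nth z1 (z1 :: t) j.

(** The graph of the morphism to be built: one word, applied at the same position of both cube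
    paths, yields [x] and [z]. *)
Definition same_face (x : cell P) (z : cell Z) :=
  exists j u, [/\ j <= size s, face_of u x (xs j) & face_of u z (zs j)].

Let szt : size t = size s.
Proof. by rewrite -(cube_path_via_size ps) (cube_path_via_size pt). Qed.

Let tag_xs j : j <= size s -> tag (xs j) = tag (zs j).
Proof. exact: cube_path_via_tag ps pt e1. Qed.

Lemma same_face_ex x : exists z, same_face x z.
Proof.
have [j [u [le_j fx]]] := repr_gen reprP x.
have [z fz] := iter_face_ex (tag_xs le_j) fx.2.
by exists z, j, u; split=> //; split=> //; case: fx.
Qed.

(** Induction on [l], one member at a time: [repr_link] gives a word [v] for [x] as a face of the
    member at [l], [repr_unique] ties [v] to the word for the next member, and [face_of_rcons] gives
    the same tie in [Z]. *)
Lemma face_transfer x z j l u u' : j <= l -> l <= size s ->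
  face_of u x (xs j) -> face_of u' x (xs l) -> face_of u z (zs j) ->
  face_of u' z (zs l).
Proof.
move=> le_jl le_l fx fx' fz.
elim: l u' le_jl le_l fx' => [|l IHl] u'.
  rewrite leqn0 => /eqP j0 _; move: fx fz; rewrite j0 => fx fz fx'.
  by rewrite -(repr_unique reprP (leq0n _) fx fx').
rewrite leq_eqVlt => /predU1P[ej|le_jl] lt_l fx'.
  move: fx fz; rewrite ej => fx fz.
  by rewrite -(repr_unique reprP lt_l fx fx').
have le_l := ltnW lt_l.
have le_q : j <= l <= l.+1 by rewrite -ltnS le_jl /=.
have [v fv] := repr_link reprP le_q lt_l fx fx'.
have gv := IHl v le_jl le_l fv.
have := cube_path_via_nth x1 ps lt_l; have := cube_path_via_nth z1 pt.
rewrite szt => /(_ l lt_l); rewrite -/(xs l) -/(xs l.+1) -/(zs l) -/(zs l.+1).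
case: (nth _ w l) => k [] fzl fxl; rewrite /step /= in fzl fxl; last first.
  (* An event starts: the member at [l] is a lower face of the next one, so [u'] is the sorted
     extension of [v]. *)
  rewrite (repr_unique reprP lt_l fx' (face_of_rcons fv fxl)).
  exact: face_of_rcons gv fzl.
(* An event ends, and [v] is the sorted extension of [u']. Applying [u'] in [Z] gives some [z'],
   which is then also the face by [v] of the member at [l], hence equal to [z]. *)
have [z' fz'] := iter_face_ex (tag_xs lt_l) fx'.2.
have {}fz' : face_of u' z' (zs l.+1) by split=> //; case: fx'.
have := face_of_rcons fz' fzl.
rewrite -(repr_unique reprP le_l fv (face_of_rcons fx' fxl)) => gz'.
by rewrite (iter_face_fun gv.2 gz'.2).
Qed.

Lemma same_face_fun x z z' : same_face x z -> same_face x z' -> z = z'.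
Proof.
case=> j [u [le_j fx fz]] [l [u' [le_l fx' fz']]].
case: (leqP j l) => [le_jl|/ltnW le_lj].
  exact: iter_face_fun (face_transfer le_jl le_l fx fx' fz).2 fz'.2.
exact: iter_face_fun fz.2 (face_transfer le_lj le_j fx' fx fz').2.
Qed.

Lemma same_face_tag x z : same_face x z -> tag x = tag z.
Proof.
case=> j [u [le_j [_ fx] [_ fz]]]; apply/eqP.
rewrite -(eqn_add2l (size u)) -(iter_face_tag fx) -(iter_face_tag fz).
by rewrite tag_xs.
Qed.

Lemma same_face_face k nu x x' z z' : same_face x z ->
  is_face k nu x' x -> is_face k nu z' z -> same_face x' z'.
Proof.
case=> j [u [le_j fx fz]] fx' fz'; exists j, (insert_face k nu u).
by split=> //; apply: face_of_insert; eassumption.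
Qed.

Lemma same_face_sig n (x : P n) : exists z : Z n, same_face (Cell x) (Cell z).
Proof.
have [[m z] H] := same_face_ex (Cell x).
by have /= em := same_face_tag H; subst m; exists z.
Qed.

Theorem path_repr_hom : exists h : pc_hom P Z,
  map (cell_map h) (x1 :: s) = z1 :: t.
Proof.
(* The graph is total and functional, so whatever value is chosen commutes with faces. *)
pose h n (x : P n) : Z n :=
  sval (constructive_indefinite_description _ (same_face_sig x)).
have hP n (x : P n) : same_face (Cell x) (Cell (h n x)).
  by rewrite /h; case: constructive_indefinite_description.
have hF n (i : 'I_n.+1) nu (x : P n.+1) :
    h n (face i nu x) = face i nu (h n.+1 x).
  apply/Cell_inj/(same_face_fun (hP _ _)).
  by apply: (same_face_face (hP _ x)); apply: is_face_face.
exists (PcHom hF); apply: (@eq_from_nth _ z1); first by rewrite size_map /= szt.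
move=> j; rewrite size_map => lt_j; rewrite (nth_map x1) //.
have H : same_face (xs j) (zs j) by exists j, [::].
rewrite -/(xs j) -/(zs j); apply: same_face_fun H.
by case: (xs j) => n x; apply: hP.
Qed.

End Universal.

(** By [repr_gen], a morphism is determined by its values on the cube path. *)
Lemma path_repr_hom_eq (P Z : precubical) (x1 : cell P) s (h h' : pc_hom P Z) :
  path_repr x1 s ->
  map (cell_map h) (x1 :: s) = map (cell_map h') (x1 :: s) ->
  forall n (x : P n), h n x = h' n x.
Proof.
move=> reprP eh n x; apply: Cell_inj.
have [j [u [le_j [_ fx]]]] := repr_gen reprP (Cell x).
apply: iter_face_fun (iter_face_map h fx) _.
suff -> : cell_map h (nth x1 (x1 :: s) j) = cell_map h' (nth x1 (x1 :: s) j).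
  exact: (iter_face_map h' fx).
have lt_j : j < size (x1 :: s) by [].
by rewrite -!(nth_map x1 (cell_map h x1)) // eh.
Qed.

(** * Standard path objects *)

(* A cube of the standard N-cube is a vector in {0, *, 1}^N, with [None] for *;
   [fill k b] replaces the k-th * by b. *)
Notation vec := (seq (option bool)).

Fixpoint fill (k : nat) (b : bool) (v : vec) : vec :=
  match v with
  | [::] => [::]
  | Some c :: v' => Some c :: fill k b v'
  | None :: v' => if k is k'.+1 then None :: fill k' b v' else Some b :: v'
  end.

Definition free (v : vec) := count (fun a => ~~ isSome a) v.

(** The face order of the standard cube, with [u] the larger cube. *)
Definition vface (v u : vec) := all2 (fun a b => ~~ isSome b || (a == b)) v u.

(* The order 0 < * < 1, coordinatewise; cube paths increase in it. *)
Definition rank (a : option bool) :=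
  if a is Some b then (if b then 2 else 0) else 1.

Definition vle (v u : vec) := all2 (fun a b => rank a <= rank b) v u.

Definition total_rank (v : vec) := sumn (map rank v).

Lemma free_fill k b v : k < free v -> free v = (free (fill k b v)).+1.
Proof.
elim: v k => [|[c|] v IHv] k //=; first exact: IHv.
by case: k => [|k] // lt_k; congr _.+1; apply: IHv.
Qed.

Lemma fill_fill i j nu mu v : i <= j ->
  fill i nu (fill j.+1 mu v) = fill j mu (fill i nu v).
Proof. by elim: v i j => [|[c|] v IHv] [|i] [|j] //= le_ij; rewrite IHv. Qed.

Lemma vface_refl v : vface v v.
Proof. by elim: v => //= a v ->; rewrite eqxx orbT. Qed.

Lemma vface_fill k b v u : vface v u -> vface (fill k b v) u.
Proof.
elim: v k u => [|[c|] v IHv] k [|[d|] u] //=; case: k => [|k] //=.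
- by case/andP=> -> /IHv ->.
- by case/andP=> -> /IHv ->.
- exact: IHv.
- exact: IHv.
- exact: IHv.
Qed.

(** The first coordinate that is free in [u] and fixed in [v] can be filled first. *)
Lemma vface_step v u : vface v u ->
  v = u \/ exists k b, k < free u /\ vface v (fill k b u).
Proof.
elim: v u => [|a v IHv] [|[d|] u] //=; first by left.
  case/andP=> /eqP -> /IHv[->|[k [b [lt_k H]]]]; first by left.
  by right; exists k, b; rewrite /= H eqxx.
case: a => [c|] H; first by right; exists 0, c; rewrite /= eqxx H.
have [->|[k [b [lt_k {}H]]]] := IHv _ H; first by left.
by right; exists k.+1, b; rewrite /= H.
Qed.

Lemma vle_refl v : vle v v.
Proof. by elim: v => //= a v ->; rewrite leqnn. Qed.

Lemma vle_trans u v v' : vle v u -> vle u v' -> vle v v'.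
Proof.
elim: u v v' => [|b u IHu] [|a v] [|c v'] //= /andP[le1 H1] /andP[le2 H2].
by rewrite (leq_trans le1 le2) (IHu _ _ H1 H2).
Qed.

Lemma vle_fill k b v :
  if b then vle v (fill k b v) else vle (fill k b v) v.
Proof.
elim: v k => [|a v IHv] k /=; first by case: b.
case: b IHv => IHv; case: a => [c|] /=; case: k => [|k] /=;
  by rewrite ?leqnn ?IHv ?vle_refl //; apply: vle_refl.
Qed.

Lemma total_rank_fill k b v : k < free v ->
  if b then total_rank v < total_rank (fill k b v)
  else total_rank (fill k b v) < total_rank v.
Proof.
rewrite /total_rank; elim: v k => [|[c|] v IHv] k //=.
  by move/IHv; case: b {IHv}; rewrite ltn_add2l.
case: k => [_|k] /=; first by case: b {IHv}.
by move/IHv; case: b {IHv}; rewrite ltn_add2l.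
Qed.

(** Coordinatewise: where [v2] is 0 so is [v1], where [v2] is 1 so is [v3], and either one forces
    the value of [v]. This yields [repr_link]. *)
Lemma vface_between v v1 v2 v3 : vface v v1 -> vface v v3 ->
  vle v1 v2 -> vle v2 v3 -> vface v v2.
Proof.
elim: v v1 v2 v3 => [|a v IHv] [|a1 v1] [|a2 v2] [|a3 v3] //=.
case/andP=> f1 F1 /andP[f3 F3] /andP[l1 L1] /andP[l2 L2].
rewrite (IHv _ _ _ F1 F3 L1 L2) andbT.
by case: a a1 a2 a3 f1 f3 l1 l2 => [[]|] [[]|] [[]|] [[]|].
Qed.

(** * Words of faces acting on vectors *)

Definition fills (w : seq (nat * bool)) (v : vec) :=
  foldr (fun a => fill a.1 a.2) v w.

Definition shift (w : seq (nat * bool)) := [seq (a.1.+1, a.2) | a <- w].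

Lemma fills_Some w c v : fills w (Some c :: v) = Some c :: fills w v.
Proof. by elim: w => //= a w ->. Qed.

Lemma fills_shift w v : fills (shift w) (None :: v) = None :: fills w v.
Proof. by elim: w => //= a w ->. Qed.

Lemma sorted_shift w : sorted ltn (unzip1 (shift w)) = sorted ltn (unzip1 w).
Proof.
have -> : unzip1 (shift w) = map succn (unzip1 w).
  by rewrite /unzip1 /shift -!map_comp.
by rewrite sorted_map.
Qed.

(** A strictly increasing word can contain index 0 only at its head. The two cases say whether a
    leading * is kept or filled. *)
Lemma sorted_faces_cases w : sorted ltn (unzip1 w) ->
  (exists w1, w = shift w1) \/ (exists b w1, w = (0, b) :: shift w1).
Proof.
have pos w' : all (ltn 0) (unzip1 w') -> exists w1, w' = shift w1.
  elim: w' => [|[[|k] b] w' IHw'] //=; first by exists [::].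
  by case/IHw'=> w1 ->; exists ((k, b) :: w1).
case: w => [|[[|k] b] w] /=; first by left; exists [::].
  by move/(order_path_min ltn_trans)/pos=> [w1 ->]; right; exists b, w1.
move=> sw; left; apply: pos => /=; have := order_path_min ltn_trans sw.
by apply: sub_all => m /=; apply: leq_trans.
Qed.

Lemma all_shift n w :
  all (fun a => a.1 < n.+1) (shift w) = all (fun a => a.1 < n) w.
Proof. by rewrite all_map. Qed.

(** The head of the result tells whether a leading * was filled, and by what; the rest is induction.
    The bounds exclude indices beyond the last *, at which [fill] changes nothing. This yields
    [repr_unique]. *)
Lemma fills_inj w w' v :
  sorted ltn (unzip1 w) -> sorted ltn (unzip1 w') ->
  all (fun a => a.1 < free v) w -> all (fun a => a.1 < free v) w' ->
  fills w v = fills w' v -> w = w'.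
Proof.
elim: v w w' => [|[c|] v IHv] w w' sw sw'.
- by case: w w' {sw sw'} => [|a w] [|a' w'].
- by move=> bw bw'; rewrite !fills_Some => -[]; apply: IHv.
have tl b w1 : sorted ltn (unzip1 ((0, b) :: shift w1)) ->
    sorted ltn (unzip1 w1).
  by move/path_sorted; rewrite sorted_shift.
case: (sorted_faces_cases sw) (sorted_faces_cases sw')
  => [[w1 e]|[b [w1 e]]] [[w1' e']|[b' [w1' e']]]; subst w w';
  rewrite /= ?all_shift ?fills_shift => bw bw' // [].
- by move/IHv=> -> //; rewrite -sorted_shift.
- by move=> -> /IHv -> //; apply: tl; eassumption.
Qed.

(** * The precubical set generated by a list of vectors *)

Section Grid.

Variable l : seq vec.

(** Membership is boolean, so cubes with the same vector are equal. *)
Definition grid_cube (n : nat) :=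
  {v : vec | (free v == n) && has (vface v) l}.

Lemma grid_face_subproof n (i : 'I_n.+1) nu (x : grid_cube n.+1) :
  (free (fill i nu (val x)) == n) && has (vface (fill i nu (val x))) l.
Proof.
case: x => v /= /andP[/eqP ev /hasP[u lu vu]]; apply/andP; split.
  by rewrite -eqSS -free_fill ev.
by apply/hasP; exists u => //; apply: vface_fill.
Qed.

Definition grid_face n (i : 'I_n.+1) nu (x : grid_cube n.+1) : grid_cube n :=
  exist _ (fill i nu (val x)) (grid_face_subproof i nu x).

Lemma grid_face_face n (i j : 'I_n.+1) (nu mu : bool) (x : grid_cube n.+2) :
  i <= j ->
  grid_face i nu (grid_face (lift ord0 j) mu x) =
  grid_face j mu (grid_face (widen_ord (leqnSn n.+1) i) nu x).
Proof. by move=> le_ij; apply: val_inj; rewrite /= fill_fill. Qed.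

Definition grid := Precubical grid_face_face.

Definition vec_of (x : cell grid) : vec := val (tagged x).

Lemma free_vec_of x : free (vec_of x) = tag x.
Proof. by case: x => n x; have /andP[/eqP] := valP x. Qed.

Lemma vec_of_inj : injective vec_of.
Proof.
move=> x y e; have := free_vec_of x; rewrite e free_vec_of.
case: x y e => n x [m y] /= e em; subst m.
by rewrite (val_inj e : x = y).
Qed.

Lemma vec_of_ex v : v \in l -> exists x, vec_of x = v.
Proof.
move=> lv; have Pv : (free v == free v) && has (vface v) l.
  by rewrite eqxx; apply/hasP; exists v => //; apply: vface_refl.
by exists (@Cell grid _ (exist _ v Pv)).
Qed.

Lemma is_face_grid k b (x y : cell grid) :
  is_face k b x y <-> k < free (vec_of y) /\ vec_of x = fill k b (vec_of y).
Proof.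
split=> [f|[lt_k e]].
  split; first by rewrite free_vec_of (is_face_lt f).
  by case: f => n [i [z [<- -> ->]]].
rewrite free_vec_of in lt_k; have [x' fx'] := is_face_ex b lt_k.
suff -> : x = x' by [].
apply: vec_of_inj; rewrite e.
by case: fx' => n [i [z [<- -> ->]]].
Qed.

Lemma iter_face_grid u (x y : cell grid) : iter_face u x y ->
  [/\ vec_of x = fills u (vec_of y), all (fun a => a.1 < free (vec_of y)) u
    & vface (vec_of x) (vec_of y)].
Proof.
elim: u x => [|[k b] u IHu] x /=.
  by move->; split=> //; apply: vface_refl.
case=> z /[dup] f /is_face_grid[lt_k ->] /[dup] fz /IHu[e -> vz].
split; last exact: vface_fill.
  by rewrite e.
rewrite andbT !free_vec_of in lt_k *; apply: leq_trans lt_k _.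
by rewrite (iter_face_tag fz) leq_addl.
Qed.

(** One coordinate is filled at a time by [vface_step], in whatever order results; sorting the word
    comes afterwards. *)
Lemma face_of_grid (x y : cell grid) :
  vface (vec_of x) (vec_of y) -> exists u, face_of u x y.
Proof.
suff fu : vface (vec_of x) (vec_of y) -> exists u, iter_face u x y.
  by move/fu=> [u /face_of_sort]; exists (sort_faces u).
move en : (tag y) => n; elim: n y en => [|n IHn] y en /vface_step.
  case=> [/vec_of_inj->|[k [b []]]]; first by exists [::].
  by rewrite free_vec_of en.
case=> [/vec_of_inj->|[k [b [lt_k vx]]]]; first by exists [::].
rewrite free_vec_of in lt_k; have [z fz] := is_face_ex b lt_k.
have ez : tag z = n by have := is_face_tag fz; rewrite en => -[].
have [_ evz] := (is_face_grid _ _ _ _).1 fz; rewrite -evz in vx.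
have [u fu] := IHn z ez vx.
by exists (rcons u (k, b)); apply: iter_face_rcons fu fz.
Qed.

(** The start of an event changes a coordinate from 0 to *, its end changes one from * to 1. *)
Lemma step_grid_vle a (x y : cell grid) :
  step a x y -> vle (vec_of x) (vec_of y).
Proof.
rewrite /step; case: a => k [] /= /is_face_grid[_ ->].
  exact: (vle_fill k true).
exact: (vle_fill k false).
Qed.

Lemma step_grid_rank a (x y : cell grid) :
  step a x y -> total_rank (vec_of x) < total_rank (vec_of y).
Proof.
rewrite /step; case: a => k [] /= /is_face_grid[lt_k ->].
  exact: (total_rank_fill true lt_k).
exact: (total_rank_fill false lt_k).
Qed.

Lemma grid_NoDup w (x : cell grid) s : cube_path_via w x s ->
  List.NoDup (x :: s) /\
  forall y, List.In y s -> total_rank (vec_of x) < total_rank (vec_of y).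
Proof.
elim: w x s => [|a w IHw] x [|y s] //=.
  by move=> _; split=> //; constructor=> //; constructor.
case=> /step_grid_rank lt_xy /IHw[ds lts].
have lt z : List.In z (y :: s) -> total_rank (vec_of x) < total_rank (vec_of z).
  by case=> [<- //|/lts]; apply: ltn_trans.
split=> //; constructor=> //.
by move/lt; rewrite ltnn.
Qed.

(** Since [l] lists the members of the path, they generate the grid. Distinctness comes from the
    strictly increasing total rank, uniqueness from [fills_inj], and linking from [vface_between]
    along the monotone path. *)
Lemma grid_path_repr w (x : cell grid) s : cube_path_via w x s ->
  map vec_of (x :: s) = l -> path_repr x s.
Proof.
move=> ps el.
have mono j q : j <= q -> q <= size s ->
    vle (vec_of (nth x (x :: s) j)) (vec_of (nth x (x :: s) q)).
  elim: q => [|q IHq]; first by rewrite leqn0 => /eqP -> _; apply: vle_refl.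
  rewrite leq_eqVlt => /predU1P[-> _|le_jq lt_q]; first exact: vle_refl.
  apply: vle_trans (IHq le_jq (ltnW lt_q)) _.
  exact: step_grid_vle (cube_path_via_nth x ps lt_q).
split.
- by exists w.
- by case: (grid_NoDup ps).
- move=> [n z]; have /andP[_ /hasP[v lv vz]] := valP z.
  have := lv; rewrite -[X in v \in X]el => /(nthP (vec_of x))[j].
  rewrite size_map => lt_j ev; rewrite -ev (nth_map x) // in vz.
  have [u fu] := @face_of_grid (Cell z) (nth x (x :: s) j) vz.
  by exists j, u.
- move=> z j u u' _ [su /iter_face_grid[e b _]] [su' /iter_face_grid[e' b' _]].
  by apply: (fills_inj su su' b b'); rewrite -e -e'.
- move=> z j q m u u' /andP[le_jq le_qm] le_m.
  move=> [_ /iter_face_grid[_ _ f]] [_ /iter_face_grid[_ _ f']].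
  apply: face_of_grid; apply: (vface_between f f'); apply: mono => //.
  exact: leq_trans le_m.
Qed.

End Grid.

(** * Realising words by paths of vectors *)

Definition vstep (a : nat * bool) (v u : vec) :=
  if a.2 then a.1 < free v /\ u = fill a.1 true v
  else a.1 < free u /\ v = fill a.1 false u.

(** Paths of bare vectors come first, since [grid] needs the whole list of members before any of its
    cells exists. *)
Fixpoint vpath (w : seq (nat * bool)) (v : vec) (s : seq vec) :=
  match w, s with
  | [::], [::] => True
  | a :: w', u :: s' => vstep a v u /\ vpath w' u s'
  | _, _ => False
  end.

(** The inserted coordinate stands for an event that has already ended. *)
Definition pad p (v : vec) := take p v ++ Some true :: drop p v.

Lemma free_pad p v : free (pad p v) = free v.
Proof. by rewrite /free count_cat /= add0n -count_cat cat_take_drop. Qed.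

Lemma fill_pad p k b v : fill k b (pad p v) = pad p (fill k b v).
Proof.
rewrite /pad; elim: v p k => [|[c|] v IHv] [|p] [|k] //=; by rewrite IHv.
Qed.

Lemma vpath_pad p w v s : vpath w v s -> vpath w (pad p v) (map (pad p) s).
Proof.
elim: w v s => [|[k b] w IHw] v [|u s] //= [st /IHw H]; split=> //.
by move: st; rewrite /vstep /=; case: b => -[lt_k ->];
  rewrite fill_pad ?free_pad.
Qed.

(** The new coordinate goes to a position where a * would be the one of index [k]; with 1 in its
    place the vector is [pad p v]. *)
Lemma unfill k v : k <= free v ->
  exists p u, free u = (free v).+1 /\ pad p v = fill k true u.
Proof.
elim: v k => [|[c|] v IHv] k.
- by rewrite leqn0 => /eqP ->; exists 0, [:: None].
- by case/IHv=> p [u [fu e]]; exists p.+1, (Some c :: u); rewrite /= -e.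
case: k => [_|k /IHv[p [u [fu e]]]]; first by exists 0, [:: None, None & v].
exists p.+1, (None :: u); rewrite /= -e; split=> //.
by rewrite /free /= -!/(free _) fu.
Qed.

(** Built backwards from the last member, taken to be the full cube of its degree. Going back over a
    start fills a * with 0; going back over an end needs a new coordinate, which is 1 in all later
    vectors. *)
Lemma vpath_ex (X : precubical) w (x : cell X) s : cube_path_via w x s ->
  exists v vs, free v = tag x /\ vpath w v vs.
Proof.
elim: w x s => [|[k b] w IHw] x [|y s] //=.
  by move=> _; exists (nseq (tag x) None), [::]; rewrite /free count_nseq mul1n.
case=> st /IHw[v [vs [fv pv]]]; rewrite /step /= in st; case: b st => st.
  have ex := is_face_tag st; have lt_k := is_face_lt st.
  have le_k : k <= free v by rewrite fv -ltnS -ex.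
  have [p [u [fu e]]] := unfill le_k.
  exists u, (pad p v :: map (pad p) vs); rewrite fu fv ex; split=> //=.
  by split; [rewrite /vstep /= fu fv -ex | apply: vpath_pad].
have lt_k := is_face_lt st; rewrite -fv in lt_k.
exists (fill k false v), (v :: vs); split=> //.
by have := free_fill false lt_k; rewrite fv (is_face_tag st) => -[].
Qed.

Lemma vpath_grid l w (x : cell (grid l)) s :
  vpath w (vec_of x) (map (@vec_of l) s) -> cube_path_via w x s.
Proof.
elim: w x s => [|[k b] w IHw] x [|y s] //= [st /IHw]; split=> //.
by move: st; rewrite /vstep /step /=; case: b => st; apply/is_face_grid.
Qed.

Lemma vec_of_seq l (vs : seq vec) : {subset vs <= l} ->
  exists s, map (@vec_of l) s = vs.
Proof.
elim: vs => [|v vs IHvs] sub; first by exists [::].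
have [x ex] := @vec_of_ex l v (sub _ (mem_head _ _)).
have [|s es] := IHvs; first by move=> u lu; apply: sub; rewrite inE lu orbT.
by exists (x :: s); rewrite /= ex es.
Qed.

Lemma path_object_ex (X : precubical) w (x : cell X) s :
  cube_path_via w x s -> tag x = 0 ->
  exists (P : hda) t,
    cube_path_via w (Cell (init P)) t /\ path_repr (Cell (init P)) t.
Proof.
move=> /vpath_ex[v [vs [fv pv]]] x0; rewrite x0 in fv.
(* The same list serves twice: it generates the grid and it is the path to be realised there. *)
have [[|y t] //] := @vec_of_seq (v :: vs) (v :: vs) (fun _ => id).
case: y => n y et; have /= [ev es] := et.
have n0 : n = 0 by have := free_vec_of (Cell y); rewrite [vec_of _]ev fv.
subst n; exists (Hda y), t.
have pt : cube_path_via w (Cell y) t.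
  by apply: vpath_grid; rewrite [vec_of _]ev es.
by split=> //; apply: grid_path_repr pt et.
Qed.

(** * Reachability *)

Lemma reachable_step (X : hda) a n (x : X n) m (y : X m) :
  reachable x -> step a (Cell x) (Cell y) -> reachable y.
Proof.
case=> s [w ps] es st; exists (rcons s (Cell y)); last by rewrite last_rcons.
exists (w ++ [:: a]); rewrite -cats1.
by apply: cube_path_via_cat ps _; rewrite es.
Qed.

Lemma reachable_init (X : hda) : reachable (init X).
Proof. by exists [::] => //; exists [::]. Qed.

Lemma reachable_last (X : hda) w s : cube_path_via w (Cell (init X)) s ->
  reachable (tagged (last (Cell (init X)) s)).
Proof. by move=> ps; exists s; [exists w | case: (last _ _)]. Qed.

Lemma cell_map_init (X Y : hda) (f : hda_hom X Y) :
  cell_map f (Cell (init X)) = Cell (init Y).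
Proof. by rewrite /cell_map /= hda_init. Qed.

Lemma reachable_map (X Y : hda) (f : hda_hom X Y) n (x : X n) :
  reachable x -> reachable (f n x).
Proof.
case=> s [w ps] es; exists (map (cell_map f) s).
  by exists w; rewrite -(cell_map_init f); apply: cube_path_via_map.
by rewrite -(cell_map_init f) last_map es.
Qed.

(* A lower face of a reachable cube is reached by taking the same faces of the
   cubes on the path to it. *)
Lemma reachable_face (X : hda) n (i : 'I_n.+1) nu (x : X n.+1) :
  reachable x -> reachable (face i nu x).
Proof.
move=> rx; case: nu.
  apply: (reachable_step (a := (val i, true))) rx _.
  exact: (is_face_face i true x).
case: rx => s [w ps] es.
suff H y k : is_face k false y (last (Cell (init X)) s) -> reachable (tagged y).
  by apply: (H (Cell (face i false x)) i); rewrite es; apply: is_face_face.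
move=> {n i x es}; elim/last_ind: s w ps y k => [|s x IHs] w ps y k.
  by move/is_face_lt.
rewrite -cats1 in ps.
have [w1 [[|[m b] [|??]] [_ {}ps]]] := cube_path_via_split ps => //=;
  last by case.
case=> st _; rewrite last_rcons => fy.
have {}IHs := IHs _ ps.
move: (last _ s) st (reachable_last ps) IHs => x' st rx' IHs.
have reach a (z z' : cell X) : reachable (tagged z) -> step a z z' ->
    reachable (tagged z').
  by case: z z' => [? ?] [? ?]; apply: reachable_step.
rewrite /step /= in st; case: b st => st.
  (* The last step ends an event: [y] is an upper face of a lower face [y'] of [x'], and the
     induction hypothesis reaches [y']. *)
  case: (leqP m k) => [le_mk|lt_km].
    have [y' f1 f2] := is_face_swapV le_mk fy st.
    exact: (reach (m, true) _ _ (IHs _ _ f2)).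
  case: m lt_km st => // m le_km st.
  have [y' f1 f2] := is_face_swap (le_km : k <= m) fy st.
  exact: (reach (m, true) _ _ (IHs _ _ f2)).
have ey := is_face_tag fy; have lt_k := is_face_lt fy.
have lt_m := is_face_lt st.
(* The last step starts an event: for [k] different from [m], a lower face [y'] of [y] is also a
   lower face of [x'], hence reachable, and starting the event again leads to [y]. For [k] equal to
   [m], [y] is [x'] itself. *)
case: (ltngtP k m) => [lt_km|lt_mk|ekm].
- case: m lt_km st lt_m => // m le_km st lt_m.
  have [y' f1] : exists y', is_face m false y' y.
    by apply: is_face_ex; rewrite -ltnS -ey.
  have [x'' f2 f3] := is_face_swapV (le_km : k <= m) f1 fy.
  rewrite (is_face_fun f3 st) in f2.
  exact: (reach (m, false) _ _ (IHs _ _ f2)).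
- case: k lt_mk fy lt_k => // k le_mk fy lt_k.
  have [y' f1] : exists y', is_face m false y' y.
    apply: is_face_ex; apply: leq_ltn_trans (le_mk : m <= k) _.
    by rewrite -ltnS -ey.
  have [x'' f2 f3] := is_face_swap (le_mk : m <= k) f1 fy.
  rewrite (is_face_fun f3 st) in f2.
  exact: (reach (m, false) _ _ (IHs _ _ f2)).
- by rewrite ekm in fy; rewrite (is_face_fun fy st).
Qed.

(** * Open maps *)

Definition lifts_lower_faces (Z X : hda) (f : hda_hom Z X) :=
  forall n (k : 'I_n.+1) (z : Z n) (x : X n.+1), reachable z ->
    f n z = face k false x ->
    exists2 y : Z n.+1, z = face k false y & f n.+1 y = x.

Lemma path_repr_hda_hom (P Z : hda) s t w :
  path_repr (Cell (init P)) s -> cube_path_via w (Cell (init P)) s ->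
  cube_path_via w (Cell (init Z)) t ->
  exists h : hda_hom P Z, map (cell_map h) s = t.
Proof.
move=> rP ps pt; have [h /= [ei et]] := path_repr_hom rP ps pt (erefl 0).
have {}ei : h 0 (init P) = init Z by apply: Cell_inj.
by exists (HdaHom ei).
Qed.

Lemma cell_map_comp (X Y Z : hda) (g : hda_hom Y Z) (f : hda_hom X Y) x :
  cell_map (hda_comp g f) x = cell_map g (cell_map f x).
Proof. by []. Qed.

Lemma path_repr_hda_hom_eq (P Z : hda) s (h h' : hda_hom P Z) :
  path_repr (Cell (init P)) s ->
  map (cell_map h) s = map (cell_map h') s ->
  forall n (x : P n), h n x = h' n x.
Proof.
move=> rP e; apply: path_repr_hom_eq rP _.
by rewrite /= !cell_map_init e.
Qed.

(** [P] realises a path to [z], and [Q] realises its image extended by [x]. The diagonal [r] sends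
    the last member [c] of the path of [Q] to the required cube. *)
Lemma open_map_lifts (Z X : hda) (f : hda_hom Z X) :
  open_map f -> lifts_lower_faces f.
Proof.
move=> of_ n k z x [s [w ps] es] ez.
have pX := cube_path_via_map f ps; rewrite cell_map_init in pX.
have stX : step (val k, false)
    (last (Cell (init X)) (map (cell_map f) s)) (Cell x).
  rewrite -(cell_map_init f) last_map es /cell_map /= ez.
  exact: is_face_face.
have pX' : cube_path_via (w ++ [:: (val k, false)]) (Cell (init X))
    (map (cell_map f) s ++ [:: Cell x]).
  exact: cube_path_via_cat.
have [P [sP [pP rP]]] := path_object_ex ps (erefl 0).
have [Q [sQ [pQ rQ]]] := path_object_ex pX' (erefl 0).
have [p ep] := path_repr_hda_hom rP pP ps.
have [q eq] := path_repr_hda_hom rQ pQ pX'.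
case/lastP: sQ pQ rQ eq => [|t c] pQ rQ.
  by have := cube_path_via_size pQ; rewrite size_cat addn1.
rewrite map_rcons cats1 => /rcons_inj eqtc.
have /= eqt := f_equal fst eqtc; have /= eqc := f_equal snd eqtc.
(* The last letter is split off because only the initial part [t] of the path of [Q] has the word of
   [P]. *)
move: (pQ); rewrite -cats1 => /cube_path_via_split[w1 [w2 [ew p1 p2]]].
case: w2 p2 ew => [|a [|??]] //= [] // stQ _.
rewrite !cats1 => /rcons_inj[ew ea].
subst w1 a.
have [e ee] := path_repr_hda_hom rP pP p1.
have ext : pointed_extension e.
  exists sP, (rcons t c); split=> //; exists [:: c].
  by rewrite /= cell_map_init ee cats1.
(* The square commutes because both composites agree on the cube path of [P]. *)
have [|r [re fr]] := of_ P Q e (HdpExt ext) p q.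
  move=> m y.
  apply: (path_repr_hda_hom_eq (h := hda_comp f p) (h' := hda_comp q e) rP).
  rewrite (eq_map (cell_map_comp f p)) (eq_map (cell_map_comp q e)).
  by rewrite !map_comp ep ee eqt.
have er (y : cell P) : cell_map r (cell_map e y) = cell_map p y.
  by rewrite /cell_map /= re.
have stZ : step (val k, false) (Cell z) (cell_map r c).
  suff <- : cell_map r (last (Cell (init Q)) t) = Cell z by apply: step_map.
  rewrite -(cell_map_init e) -ee last_map er -es.
  by rewrite -(cell_map_init p) -ep last_map.
have fc : cell_map f (cell_map r c) = Cell x.
  by apply: etrans eqc; rewrite /cell_map /= fr.
case: (cell_map r c) stZ fc => m y stZ fc.
have em : m = n.+1 by have := is_face_tag stZ.
subst m; exists y; first exact: is_face_Cell stZ.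
exact: Cell_inj fc.
Qed.

(** Ends of events lift along any morphism, by taking the upper face of [z] itself; starts lift by
    hypothesis. Reachability passes to the next member. *)
Lemma lift_cube_path (Z X : hda) (f : hda_hom Z X) w n (z : Z n) s :
  lifts_lower_faces f -> reachable z -> cube_path_via w (Cell (f n z)) s ->
  exists t, cube_path_via w (Cell z) t /\ map (cell_map f) t = s.
Proof.
move=> lf; elim: w n z s => [|[k b] w IHw] n z [|y s] //= rz.
  by exists [::].
case=> st ps; rewrite /step /= in st.
suff [m [z' [stz ey]]] : exists m (z' : Z m),
    step (k, b) (Cell z) (Cell z') /\ y = Cell (f m z').
  rewrite ey in ps; have [t [pt et]] := IHw _ _ _ (reachable_step rz stz) ps.
  by exists (Cell z' :: t); split=> //=; rewrite et ey.
case: b st => st.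
  case: n z st {rz} => [|n] z st; first by have := is_face_lt st.
  have [i [ik ->]] := is_face_inv st.
  exists n, (face i true z); rewrite -ik pc_face; split=> //.
  exact: is_face_face.
have := is_face_tag st; case: y st {ps} => m x st /= em; subst m.
have := is_face_inv st; case=> i [ik /Cell_inj ex].
have [z' ez fz'] := lf _ _ _ _ rz ex.
by exists n.+1, z'; rewrite fz' ez -ik; split=> //; apply: is_face_face.
Qed.

(** Induction on the generation of [g]. An isomorphism is inverted, a composite is lifted in two
    stages, and for an extension the added part of the path is lifted to [Z] and appended to the
    image under [p]. *)
Lemma lifts_open_map (Z X : hda) (f : hda_hom Z X) :
  lifts_lower_faces f -> open_map f.
Proof.
move=> lf P Q g; elim=> {P Q g}.
- move=> P Q g _ _ [h [gh hg]] p q epq; exists (hda_comp p h); split=> n x /=.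
    by rewrite gh.
  by rewrite epq hg.
- move=> P Q g [s [t [rP rQ [t' /= [_ et]]]]] p q epq.
  have [w ps] := repr_path rP; have [w0 pt] := repr_path rQ.
  rewrite et in pt; have [_ [w' [_ _ pt']]] := cube_path_via_split pt.
  have pg := cube_path_via_map g ps; rewrite cell_map_init in pg.
  have pp := cube_path_via_map p ps; rewrite cell_map_init in pp.
  (* The initial part of the path of [Q] is read with the word [w] of [P], so that the word agrees
     with that of the path in [Z]. *)
  have pQ := cube_path_via_cat pg pt'.
  have eend : cell_map f (last (Cell (init Z)) (map (cell_map p) s)) =
              cell_map q (last (Cell (init Q)) (map (cell_map g) s)).
    rewrite -(cell_map_init g) -(cell_map_init p) !last_map.
    by rewrite /cell_map /= epq.
  have pq := cube_path_via_map q pt'; rewrite -eend in pq.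
  have [u [pu eu]] := lift_cube_path lf (reachable_last pp) pq.
  have pu' : cube_path_via w' (last (Cell (init Z)) (map (cell_map p) s)) u.
    by move: pu; case: (last _ _).
  have pZ := cube_path_via_cat pp pu'.
  rewrite -et in pQ; have [r er] := path_repr_hda_hom rQ pQ pZ.
  rewrite et map_cat in er.
  have szs : size (map (cell_map r) (map (cell_map g) s)) =
             size (map (cell_map p) s).
    by rewrite !size_map.
  have er1 : map (cell_map r) (map (cell_map g) s) = map (cell_map p) s.
    have := f_equal (take (size (map (cell_map p) s))) er.
    by rewrite -{1}szs !take_size_cat.
  have er2 : map (cell_map r) t' = u.
    have := f_equal (drop (size (map (cell_map p) s))) er.
    by rewrite -{1}szs !drop_size_cat.
  exists r; split=> n x.
    apply: (path_repr_hda_hom_eq (h := hda_comp r g) (h' := p) rP).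
    by rewrite (eq_map (cell_map_comp r g)) map_comp.
  apply: (path_repr_hda_hom_eq (h := hda_comp f r) (h' := q) rQ).
  rewrite (eq_map (cell_map_comp f r)) map_comp et !map_cat er1 er2 eu.
  congr (_ ++ _); rewrite -!map_comp; apply: eq_map => y.
  by rewrite /= /cell_map /= epq.
- move=> P Q S g h _ IHg _ IHh p q epq.
  have [r1 [e1 f1]] := IHg p (hda_comp q h) epq.
  have [r [e2 f2]] := IHh r1 q f1.
  by exists r; split=> // n x; rewrite -e1 -e2.
Qed.

(** * Relations *)

Definition step_bisimulation (X Y : hda)
    (R : forall n, pc_prod X Y n -> Prop) :=
  [/\ precubical_subset R, R 0 (init X, init Y) &
   forall n (x1 : X n) (y1 : Y n),
     reachable x1 -> reachable y1 -> R n (x1, y1) ->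
     (forall (k : 'I_n.+1) (x2 : X n.+1), x1 = face k false x2 ->
        exists y2 : Y n.+1, y1 = face k false y2 /\ R n.+1 (x2, y2)) /\
     (forall (k : 'I_n.+1) (y2 : Y n.+1), y1 = face k false y2 ->
        exists x2 : X n.+1, x1 = face k false x2 /\ R n.+1 (x2, y2))].

Definition path_bisimulation (X Y : hda)
    (R : forall n, pc_prod X Y n -> Prop) :=
  [/\ precubical_subset R, R 0 (init X, init Y) &
   forall n (x1 : X n) (y1 : Y n),
     reachable x1 -> reachable y1 -> R n (x1, y1) ->
     (forall w (xs : seq (cell X)), cube_path_via w (Cell x1) xs ->
        exists ys : seq (cell Y),
          cube_path_via w (Cell y1) ys /\ List.Forall2 (cell_rel R) xs ys) /\
     (forall w (ys : seq (cell Y)), cube_path_via w (Cell y1) ys ->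
        exists xs : seq (cell X),
          cube_path_via w (Cell x1) xs /\ List.Forall2 (cell_rel R) xs ys)].

Lemma bisimilar_step (X Y : hda) :
  bisimilar X Y -> exists R, @step_bisimulation X Y R.
Proof.
case=> Z [f [g [/open_map_lifts lf /open_map_lifts lg]]].
(* Reachability of [z] is recorded because lower faces lift only at reachable cubes. *)
exists (fun n xy => exists z : Z n, reachable z /\ xy = (f n z, g n z)); split.
- move=> n i nu _ [z [rz ->]]; exists (face i nu z).
  by rewrite /= /prod_face /= !pc_face; split=> //; apply: reachable_face.
- by exists (init Z); rewrite !hda_init; split=> //; apply: reachable_init.
move=> n _ _ _ _ [z [rz [-> ->]]]; split=> k c ec.
  have [y ez fy] := lf _ _ _ _ rz ec.
  exists (g _ y); rewrite ez pc_face; split=> //; exists y; rewrite fy.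
  split=> //; apply: (reachable_step (a := (val k, false))) rz _.
  by rewrite ez; apply: is_face_face.
have [y ez gy] := lg _ _ _ _ rz ec.
exists (f _ y); rewrite ez pc_face; split=> //; exists y; rewrite gy.
split=> //; apply: (reachable_step (a := (val k, false))) rz _.
by rewrite ez; apply: is_face_face.
Qed.

(** * Precubical subsets as precubical sets *)

Section Subobject.

Variables (X : precubical) (S : forall n, X n -> Prop).
Hypothesis subS : precubical_subset S.

Definition sub_face n (i : 'I_n.+1) nu (x : sig (@S n.+1)) : sig (@S n) :=
  exist _ (face i nu (sval x)) (subS i nu (svalP x)).

(** Membership is an arbitrary proposition, hence the appeal to proof irrelevance. *)
Lemma sub_face_face n (i j : 'I_n.+1) (nu mu : bool) (x : sig (@S n.+2)) :
  i <= j ->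
  sub_face i nu (sub_face (lift ord0 j) mu x) =
  sub_face j mu (sub_face (widen_ord (leqnSn n.+1) i) nu x).
Proof. by move=> le_ij; apply/subset_eq_compat/face_face. Qed.

Definition pc_sub := Precubical sub_face_face.

End Subobject.

(** The two clauses of the step condition are the lifting properties of the two projections; these
    preserve reachability, so the clauses apply at every reachable pair. *)
Lemma step_bisimilar (X Y : hda) R : @step_bisimulation X Y R -> bisimilar X Y.
Proof.
case=> subR R0 stR; pose Z := @Hda (pc_sub subR) (exist _ _ R0).
pose f := @HdaHom Z X (@PcHom (pc_sub subR) X (fun n z => (sval z).1)
  (fun _ _ _ _ => erefl)) erefl.
pose g := @HdaHom Z Y (@PcHom (pc_sub subR) Y (fun n z => (sval z).2)
  (fun _ _ _ _ => erefl)) erefl.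
exists Z, f, g; split; apply: lifts_open_map => n k [[x y] Rxy] c rz /= ec;
  have := stR n x y (reachable_map f rz) (reachable_map g rz) Rxy.
  case=> /(_ k c ec)[d [ed Rcd]] _.
  by exists (exist _ (c, d) Rcd) => //; apply: subset_eq_compat; rewrite ec ed.
case=> _ /(_ k c ec)[d [ed Rcd]].
by exists (exist _ (d, c) Rcd) => //; apply: subset_eq_compat; rewrite ec ed.
Qed.

(** A path with the single step [(k, false)] suffices; the shared word keeps the index [k] on the
    other side. *)
Lemma path_step_bisimulation (X Y : hda) R :
  @path_bisimulation X Y R -> step_bisimulation R.
Proof.
case=> subR R0 ptR; split=> // n x1 y1 rx ry R1.
have rel m (x : X m) (y : Y m) : cell_rel R (Cell x) (Cell y) -> R m (x, y).
  case=> l [a [b [ex ey Rab]]]; have /= em := f_equal (@tag _ _) ex.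
  by subst l; rewrite (Cell_inj ex) (Cell_inj ey).
have [Hx Hy] := ptR n x1 y1 rx ry R1; split=> k c ec.
  have [|ys [py Fxy]] := Hx [:: (val k, false)] [:: Cell c].
    by split=> //; rewrite ec; apply: is_face_face.
  case: ys py Fxy => [|[m d] [|??]] //= [st []] Fxy.
  have em := is_face_tag st; rewrite /= in em; subst m.
  exists d; split; first exact: is_face_Cell st.
  by apply: rel; inversion Fxy.
have [|xs [px Fxy]] := Hy [:: (val k, false)] [:: Cell c].
  by split=> //; rewrite ec; apply: is_face_face.
case: xs px Fxy => [|[m d] [|??]] //= [st []] Fxy.
have em := is_face_tag st; rewrite /= in em; subst m.
exists d; split; first exact: is_face_Cell st.
by apply: rel; inversion Fxy.
Qed.

(** Ends of events are matched by closure under faces, starts by the step condition. The relation is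
    curried so that the lemma also applies with [X] and [Y] exchanged. *)
Lemma match_cube_path (X Y : hda) (R : forall n, X n -> Y n -> Prop) :
  (forall n (i : 'I_n.+1) nu x y,
     R n.+1 x y -> R n (face i nu x) (face i nu y)) ->
  (forall n (k : 'I_n.+1) x1 y1 x2, reachable x1 -> reachable y1 ->
     R n x1 y1 -> x1 = face k false x2 ->
     exists y2, y1 = face k false y2 /\ R n.+1 x2 y2) ->
  forall w n (x1 : X n) (y1 : Y n) xs, reachable x1 -> reachable y1 ->
    R n x1 y1 -> cube_path_via w (Cell x1) xs ->
    exists ys, cube_path_via w (Cell y1) ys /\
      List.Forall2 (fun x y => exists n (a : X n) (b : Y n),
        [/\ x = Cell a, y = Cell b & R n a b]) xs ys.
Proof.
move=> faceR stR; elim=> [|[k b] w IHw] n x1 y1 [|c xs] //= rx ry R1.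
  by exists [::].
case=> st ps.
suff [m [x2 [y2 [ec st' R2]]]] : exists m (x2 : X m) (y2 : Y m),
    [/\ c = Cell x2, step (k, b) (Cell y1) (Cell y2) & R m x2 y2].
  subst c; have rx2 := reachable_step rx st; have ry2 := reachable_step ry st'.
  have [ys [py F]] := IHw _ _ _ _ rx2 ry2 R2 ps.
  by exists (Cell y2 :: ys); split=> //; constructor=> //; exists m, x2, y2.
rewrite /step /= in st; case: b st => st.
  case: n x1 y1 st {rx ry} R1 => [|n] x1 y1 st R1.
    by have := is_face_lt st.
  have [i [ik ec]] := is_face_inv st.
  exists n, (face i true x1), (face i true y1); split=> //; last exact: faceR.
  by rewrite -ik; apply: is_face_face.
have := is_face_tag st; case: c st {ps} => m x2 st /= em; subst m.
have [i [ik /Cell_inj ex]] := is_face_inv st.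
have [y2 [ey R2]] := stR _ _ _ _ _ rx ry R1 ex.
by exists n.+1, x2, y2; split=> //; rewrite ey -ik; apply: is_face_face.
Qed.

Lemma step_path_bisimulation (X Y : hda) R :
  @step_bisimulation X Y R -> path_bisimulation R.
Proof.
case=> subR R0 stR; split=> // n x1 y1 rx ry R1; split=> w zs ps.
  apply: (match_cube_path (R := fun n x y => R n (x, y)) _ _ rx ry R1 ps).
    by move=> m i nu x y; apply: subR.
  by move=> m k x y x2 rx' ry' /(stR _ _ _ rx' ry')[H _]; apply: H.
(* The second clause is the first for the converse relation; the resulting [Forall2] is flipped
   back. *)
have [||xs [px F]] :=
  match_cube_path (R := fun n y x => R n (x, y)) _ _ ry rx R1 ps.
- by move=> m i nu y x; apply: subR.
- by move=> m k y x y2 ry' rx' /(stR _ _ _ rx' ry')[_ H]; apply: H.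
exists xs; split=> //; apply: List.Forall2_impl (List.Forall2_flip F).
by move=> x y [m [a [b [-> -> Rab]]]]; exists m, b, a.
Qed.

Theorem theorem3p4 (X Y : hda) :
  (bisimilar X Y <->
   exists R : forall n, pc_prod X Y n -> Prop,
     [/\ precubical_subset R, R 0 (init X, init Y) &
      forall n (x1 : X n) (y1 : Y n),
        reachable x1 -> reachable y1 -> R n (x1, y1) ->
        (forall (k : 'I_n.+1) (x2 : X n.+1), x1 = face k false x2 ->
           exists y2 : Y n.+1, y1 = face k false y2 /\ R n.+1 (x2, y2)) /\
        (forall (k : 'I_n.+1) (y2 : Y n.+1), y1 = face k false y2 ->
           exists x2 : X n.+1, x1 = face k false x2 /\ R n.+1 (x2, y2))]) /\
  (bisimilar X Y <->
   exists R : forall n, pc_prod X Y n -> Prop,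
     [/\ precubical_subset R, R 0 (init X, init Y) &
      forall n (x1 : X n) (y1 : Y n),
        reachable x1 -> reachable y1 -> R n (x1, y1) ->
        (forall w (xs : seq (cell X)), cube_path_via w (Cell x1) xs ->
           exists ys : seq (cell Y),
             cube_path_via w (Cell y1) ys /\
             List.Forall2 (cell_rel R) xs ys) /\
        (forall w (ys : seq (cell Y)), cube_path_via w (Cell y1) ys ->
           exists xs : seq (cell X),
             cube_path_via w (Cell x1) xs /\
             List.Forall2 (cell_rel R) xs ys)]).
Proof.
have [H1 H2] : (bisimilar X Y <-> exists R, @step_bisimulation X Y R) /\
               (bisimilar X Y <-> exists R, @path_bisimulation X Y R).
  split; split=> [/bisimilar_step|[R]] //.
  - exact: step_bisimilar.
  - by case=> R /step_path_bisimulation; exists R.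
  - by move/path_step_bisimulation/step_bisimilar.
by split.
Qed.
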